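(* Let $M \in \mathbb{R}^{m\times m}$ and $N \in \mathbb{R}^{n\times n}$ be symmetric positive definite, $A \in \mathbb{R}^{m\times n}$, and let $b \in \mathbb{R}^m$ and $c\in\mathbb{R}^n$ be nonzero. Set $$K = \begin{bmatrix} M & A \\ A^T & -N\end{bmatrix},\qquad H = \begin{bmatrix} M & 0 \\ 0 & N\end{bmatrix},\qquad B = \begin{bmatrix} b & 0 \\ 0 & c\end{bmatrix}.$$ Let $k\ge 1$ and suppose that the orthogonal tridiagonalization process in elliptic norms (see context) applied to $A$ with initial vectors $b$ and $c$ does not terminate before producing $v_1,\dots,v_{k+1}$ and $u_1,\dots,u_{k+1}$. Then, given the matrix $K$ and the block right-hand side $B$, the preconditioned Krylov basis $W_k$ generated by the preconditioned block-Lanczos process (see context) with preconditioner $H$ has the form $$W_k = \begin{bmatrix} w_1 & \cdots & w_k\end{bmatrix},\qquad w_j = \begin{bmatrix} v_j & 0 \\ 0 & u_j\end{bmatrix},$$ where the vectors $v_j$ and $u_j$ are the same as those generated by the orthogonal tridiagonalization process in elliptic norms with initial vectors $b$ and $c$. In addition, $$K W_k = H W_{k+1} S_{k+1,k},\qquad S_{k+1,k} := \begin{bmatrix} \Theta_1 & \Psi_2 & & \\ \Psi_2^T & \Theta_2 & \ddots & \\ & \ddots & \ddots & \Psi_k \\ & & \ddots & \Theta_k \\ & & & \Psi_{k+1}^T\end{bmatrix} \in \mathbb{R}^{(2k+2)\times 2k},$$ where $$\Theta_j = \begin{bmatrix} 1 & \alpha_j \\ \alpha_j & -1\end{bmatrix}\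 (1\le j\le k),\qquad \Psi_j = \begin{bmatrix} 0 & \gamma_j \\ \beta_j & 0\end{bmatrix}\ (2\le j\le k+1),$$ and the scalars $\alpha_j$, $\beta_j$ and $\gamma_j$ are those generated by the orthogonal tridiagonalization process in elliptic norms when it is applied to $A$ with initial vectors $b$ and $c$.
   Context: All computations are in exact arithmetic. Orthogonal tridiagonalization process in elliptic norms, applied to $A$ with initial vectors $b,c$: set $v_0=0$, $u_0=0$. Define $\beta_1>0$, $v_1$ by $\beta_1 M v_1 = b$ with $v_1^T M v_1 = 1$, and $\gamma_1>0$, $u_1$ by $\gamma_1 N u_1 = c$ with $u_1^T N u_1 = 1$. For $j=1,2,\dots$: set $q = A u_j - \gamma_j M v_{j-1}$, $\alpha_j = v_j^T q$, $p = A^T v_j - \beta_j N u_{j-1}$, and define $\beta_{j+1}>0$, $v_{j+1}$, $\gamma_{j+1}>0$, $u_{j+1}$ by $$\beta_{j+1} M v_{j+1} = q - \alpha_j M v_j,\quad v_{j+1}^T M v_{j+1} = 1,\qquad \gamma_{j+1} N u_{j+1} = p - \alpha_j N u_j,\quad u_{j+1}^T N u_{j+1} = 1.$$ The process terminates if there is an index $j$ for which $\beta_{j+1}=0$ or $\gamma_{j+1}=0$. Preconditioned block-Lanczos process, applied to a symmetric matrix $C\in\mathbb{R}^{(m+n)\times(m+n)}$ with symmetric positive definite preconditioner $H$ and initial block $B\in\mathbb{R}^{(m+n)\times 2}$: set $w_0=0$ and determine $w_1\in\mathbb{R}^{(m+n)\times 2}$, $\Psi_1\in\mathbb{R}^{2\times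 2}$ such that $H w_1\Psi_1^T = B$ and $w_1^T H w_1 = I_2$. For $j=1,2,\dots$: set $\Omega_j = w_j^T C w_j$ and determine $w_{j+1}\in\mathbb{R}^{(m+n)\times 2}$, $\Psi_{j+1}\in\mathbb{R}^{2\times2}$ such that $$H w_{j+1}\Psi_{j+1}^T = C w_j - H w_j\Omega_j - H w_{j-1}\Psi_j,\qquad w_{j+1}^T H w_{j+1} = I_2.$$ In the claim the process is applied with $C=K$, and its diagonal blocks $w_j^T K w_j$ are denoted $\Theta_j$. *)

(* Defs.v *)
From HB Require Import structures.
From mathcomp Require Import all_boot all_order all_algebra.
From mathcomp Require Import reals.

Set Implicit Arguments.
Unset Strict Implicit.
Unset Printing Implicit Defensive.

Import Order.TTheory GRing.Theory Num.Theory.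

Local Open Scope ring_scope.

Definition spd (R : realType) (n : nat) (M : 'M[R]_n) : Prop :=
  M^T = M /\ forall x : 'cV[R]_n, x != 0 -> 0 < (x^T *m M *m x) 0 0.

Definition mx22 (R : realType) (a b c d : R) : 'M[R]_2 :=
  (block_mx a%:M b%:M c%:M d%:M : 'M_(1 + 1)).

(* Sequences are indexed by nat as in the usual 1-based notation: only v 0,
   u 0, the entries 1..k+1 of v, u, beta, gamma and the entries 1..k of alpha
   are constrained.  Positivity of beta_j and gamma_j for all j <= k+1 says
   that the process has not terminated before v_{k+1} and u_{k+1}. *)
Record tridiag_run (R : realType) (m n : nat) (M : 'M[R]_m) (N : 'M[R]_n)
    (A : 'M[R]_(m, n)) (b : 'cV[R]_m) (c : 'cV[R]_n) (k : nat)
    (v : nat -> 'cV[R]_m) (u : nat -> 'cV[R]_n)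
    (alpha beta gamma : nat -> R) : Prop := TridiagRun {
  tridiag_v0 : v 0%N = 0;
  tridiag_u0 : u 0%N = 0;
  tridiag_beta_gt0 : forall j, (1 <= j <= k.+1)%N -> 0 < beta j;
  tridiag_gamma_gt0 : forall j, (1 <= j <= k.+1)%N -> 0 < gamma j;
  tridiag_v_norm : forall j, (1 <= j <= k.+1)%N ->
    (v j)^T *m M *m v j = 1%:M;
  tridiag_u_norm : forall j, (1 <= j <= k.+1)%N ->
    (u j)^T *m N *m u j = 1%:M;
  tridiag_v1 : beta 1%N *: (M *m v 1%N) = b;
  tridiag_u1 : gamma 1%N *: (N *m u 1%N) = c;
  tridiag_step : forall j, (1 <= j <= k)%N ->
    let q := A *m u j - gamma j *: (M *m v j.-1) in
    let p := A^T *m v j - beta j *: (N *m u j.-1) in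
    [/\ alpha j = ((v j)^T *m q) 0 0,
        beta j.+1 *: (M *m v j.+1) = q - alpha j *: (M *m v j) &
        gamma j.+1 *: (N *m u j.+1) = p - alpha j *: (N *m u j)]
}.

(* The first k steps of the preconditioned block-Lanczos process.  The process
   only requires H w_{j+1} Psi_{j+1}^T to be some factorization of the residual
   with w_{j+1} H-orthonormal, hence a relation and not a function. *)
Record block_lanczos_run (R : realType) (d : nat) (C H : 'M[R]_d)
    (B : 'M[R]_(d, 2)) (k : nat) (w : nat -> 'M[R]_(d, 2))
    (Omega Psi : nat -> 'M[R]_2) : Prop := BlockLanczosRun {
  block_lanczos_w0 : w 0%N = 0;
  block_lanczos_w1 : H *m w 1%N *m (Psi 1%N)^T = B;
  block_lanczos_norm : forall j, (1 <= j <= k.+1)%N ->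
    (w j)^T *m H *m w j = 1%:M;
  block_lanczos_Omega : forall j, (1 <= j <= k)%N ->
    Omega j = (w j)^T *m C *m w j;
  block_lanczos_step : forall j, (1 <= j <= k)%N ->
    H *m w j.+1 *m (Psi j.+1)^T
      = C *m w j - H *m w j *m Omega j - H *m w j.-1 *m Psi j
}.

(* [w_1 ... w_k]; its width \sum_(j < k) 2 equals 2k. *)
Definition krylov_basis (R : realType) (d : nat) (w : nat -> 'M[R]_(d, 2))
    (k : nat) : 'M[R]_(d, \sum_(j < k) 2) :=
  \mxrow_(j < k) w j.+1.

(* S_{k+1,k}.  The block indices i, j below are 0-based, whereas those of Theta
   and Psi are 1-based. *)
Definition lanczos_mx (R : realType) (Theta Psi : nat -> 'M[R]_2) (k : nat) :
    'M[R]_(\sum_(i < k.+1) 2, \sum_(j < k) 2) :=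
  \mxblock_(i < k.+1, j < k)
    (if i == j :> nat then Theta j.+1
     else if i == j.+1 :> nat then (Psi j.+2)^T
     else if i.+1 == j :> nat then Psi j.+1
     else 0).

(* Main.v *)
(** The recurrences make consecutive [v_j] (resp. [u_j]) M- (resp. N-) orthogonal,
so [alpha_j = v_j^T A u_j] and the blocks [w_j = diag(v_j, u_j)] satisfy the
block-Lanczos recurrence by block multiplication.  For uniqueness, let a second
run satisfy [w'_i = w_i Q_i] up to index [j].  Then
[Psi'_j = Q_{j-1}^T Psi_j Q_j], hence its residual at step [j] is that of the
first run times [Q_j].  As [Psi_{j+1}] is invertible, two H-orthonormal
factorizations of this residual differ by an orthogonal matrix [Q_{j+1}]. *)

Require Import Defs.
From HB Require Import structures.
From mathcomp Require Import all_boot all_order all_algebra.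
From mathcomp Require Import reals.

Set Implicit Arguments.
Unset Strict Implicit.
Unset Printing Implicit Defensive.

Import Order.TTheory GRing.Theory Num.Theory.

Local Open Scope ring_scope.

(** * Invertibility, small block matrices and H-orthonormal factorizations *)

Lemma spd_unitmx (R : realType) (n : nat) (M : 'M[R]_n) : spd M -> M \in unitmx.
Proof.
move=> [_ Mpos]; rewrite -row_free_unit -kermx_eq0.
apply/negPn/negP => /rowV0Pn[x /sub_kermxP xM0 x_neq0].
have := Mpos x^T; rewrite trmx_eq0 trmxK xM0 mul0mx mxE ltxx.
by move=> /(_ x_neq0).
Qed.

Lemma mx22_diag_unitmx (R : realType) (a d : R) :
  a != 0 -> d != 0 -> mx22 a 0 0 d \in unitmx.
Proof.
move=> a0 d0; rewrite unitmxE /mx22 raddf0.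
by rewrite (@det_ublock _ 1 1) !det_scalar1 unitfE mulf_neq0.
Qed.

Lemma mx22_antidiag_unitmx (R : realType) (b c : R) :
  b != 0 -> c != 0 -> mx22 0 b c 0 \in unitmx.
Proof.
move=> b0 c0.
have : mx22 0 b c 0 *m mx22 0 c^-1 b^-1 0 = 1%:M.
  rewrite /mx22 (@mulmx_block _ 1 1 1 1 1 1) -!scalar_mxM -!raddfD /=.
  rewrite !mulr0 !mul0r !addr0 !add0r !mulfV // raddf0.
  exact/esym/(@scalar_mx_block _ 1 1).
by move=> /mulmx1_unit[].
Qed.

Lemma trmx_mx22 (R : realType) (a b c d : R) : (mx22 a b c d)^T = mx22 a c b d.
Proof. by rewrite /mx22 (@tr_block_mx _ 1 1 1 1) !tr_scalar_mx. Qed.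

Lemma block_diag_mul_mx22 (R : realType) (m n : nat) (x : 'cV[R]_m) (y : 'cV[R]_n)
    (a b c d : R) :
  (block_mx x 0 0 y : 'M_(m + n, 1 + 1)) *m mx22 a b c d
    = block_mx (a *: x) (b *: x) (c *: y) (d *: y).
Proof.
rewrite /mx22 (@mulmx_block _ m n 1 1 1 1) !mul0mx !addr0 !add0r.
by rewrite !mul_mx_scalar.
Qed.

(** The witness is [Q = w^T H w']. Cancelling [H] and multiplying by [w^T H] gives
    [Q *m P' = P *m Q0], whose right side is invertible; hence so is [P'], and it can be cancelled
    to get [w' = w *m Q]. The two normalizations then force [Q] to be orthogonal. *)
Lemma factorization_unique (R : realType) (d r : nat) (H : 'M[R]_d)
    (w w' : 'M[R]_(d, r)) (P P' Q0 : 'M[R]_r) :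
  H \in unitmx -> P \in unitmx -> Q0 \in unitmx ->
  w^T *m H *m w = 1%:M -> w'^T *m H *m w' = 1%:M ->
  H *m w' *m P' = H *m w *m P *m Q0 ->
  exists Q : 'M[R]_r,
    [/\ Q^T *m Q = 1%:M, w' = w *m Q & Q *m P' = P *m Q0].
Proof.
move=> Hu Pu Q0u ww ww' e.
have e' : w' *m P' = w *m P *m Q0.
  by apply: (can_inj (mulKmx Hu)); rewrite !mulmxA.
pose Q := w^T *m H *m w'.
have QP : Q *m P' = P *m Q0.
  by rewrite /Q -mulmxA e' !mulmxA ww mul1mx.
clearbody Q.
have P'u : P' \in unitmx.
  have : Q *m P' \in unitmx by rewrite QP unitmx_mul Pu.
  by rewrite unitmx_mul => /andP[].
have wQ : w' = w *m Q.
  by apply: (can_inj (mulmxK P'u)); rewrite e' -!mulmxA QP.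
exists Q; split=> //.
by rewrite -[RHS]ww' wQ trmx_mul !mulmxA -(mulmxA Q^T) -(mulmxA Q^T) ww mulmx1.
Qed.

(** * Block-Lanczos runs: uniqueness and matrix form *)

Section BlockLanczos.
Variables (R : realType) (d : nat) (C H : 'M[R]_d) (B : 'M[R]_(d, 2)) (k : nat).
Variables (w : nat -> 'M[R]_(d, 2)) (Omega Psi : nat -> 'M[R]_2).
Hypothesis run : block_lanczos_run C H B k w Omega Psi.

(* The third conjunct makes the residuals at step [j.+1] agree up to [Q]; it is
part of the conclusion only to strengthen the induction hypothesis. *)
Lemma block_lanczos_unique (w' : nat -> 'M[R]_(d, 2)) (Omega' Psi' : nat -> 'M[R]_2) :
  H \in unitmx -> (forall j, (1 <= j <= k.+1)%N -> Psi j \in unitmx) ->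
  block_lanczos_run C H B k w' Omega' Psi' ->
  forall j, (j <= k)%N ->
  exists Q : 'M[R]_2, [/\ Q^T *m Q = 1%:M, w' j.+1 = w j.+1 *m Q &
    w' j *m Psi' j.+1 = w j *m Psi j.+1 *m Q].
Proof.
move=> Hu Psiu run'; elim=> [_|j IHj jk].
  have [|||||Q [QQ wQ _]] :=
    @factorization_unique R d 2 H (w 1%N) (w' 1%N) (Psi 1%N)^T (Psi' 1%N)^T 1%:M Hu.
  - by rewrite unitmx_tr Psiu.
  - exact: unitmx1.
  - exact: (block_lanczos_norm run).
  - exact: (block_lanczos_norm run').
  - by rewrite mulmx1 (block_lanczos_w1 run) (block_lanczos_w1 run').
  exists Q; split=> //.
  by rewrite (block_lanczos_w0 run) (block_lanczos_w0 run') !mul0mx.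
have [Q0 [QQ0 wQ0 PQ0]] := IHj (ltnW jk).
have Q0Q : Q0 *m Q0^T = 1%:M by exact: mulmx1C.
have [_ Q0u] := mulmx1_unit QQ0.
have j1k : (1 <= j.+1 <= k)%N by [].
have j2k : (1 <= j.+2 <= k.+1)%N by [].
have [|||||Q [QQ wQ QP]] :=
    @factorization_unique R d 2 H (w j.+2) (w' j.+2) (Psi j.+2)^T (Psi' j.+2)^T Q0 Hu.
- by rewrite unitmx_tr Psiu.
- exact: Q0u.
- exact: (block_lanczos_norm run).
- exact: (block_lanczos_norm run').
(* In the middle term [Omega' j.+1] is [Q0^T *m Omega j.+1 *m Q0], and [Q0 *m Q0^T] cancels; the
   last term is the third conjunct of the induction hypothesis. *)
- rewrite (block_lanczos_step run j1k) (block_lanczos_step run' j1k) /=.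
  rewrite (block_lanczos_Omega run j1k) (block_lanczos_Omega run' j1k).
  rewrite -(mulmxA H (w' j)) PQ0 wQ0 trmx_mul !mulmxBl !mulmxA.
  by rewrite -(mulmxA (H *m w j.+1) Q0) Q0Q mulmx1.
exists Q; split=> //.
have QPt : Psi' j.+2 *m Q^T = Q0^T *m Psi j.+2.
  by apply: trmx_inj; rewrite !trmx_mul !trmxK QP.
have -> : Psi' j.+2 = Q0^T *m Psi j.+2 *m Q by rewrite -QPt -mulmxA QQ mulmx1.
by rewrite wQ0 !mulmxA -(mulmxA (w j.+1)) Q0Q mulmx1.
Qed.

(** Each block column is one step of the recurrence solved for [C *m w j.+1]: its terms are the
    diagonal, subdiagonal and superdiagonal blocks. *)
Lemma block_lanczos_krylov :
  C *m krylov_basis w k = H *m krylov_basis w k.+1 *m lanczos_mx Omega Psi k.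
Proof.
rewrite /krylov_basis /lanczos_mx !mul_mxrow mul_mxrow_mxblock.
apply/eq_mxrow => j.
have jk : (1 <= j.+1 <= k)%N by rewrite /= ltn_ord.
have := block_lanczos_step run jk => /= step.
have jk1 : (j < k.+1)%N by rewrite ltnW // ltnS ltn_ord.
have j1k1 : (j.+1 < k.+1)%N by rewrite ltnS ltn_ord.
rewrite (bigD1 (Ordinal jk1)) //= eqxx.
rewrite (bigD1 (Ordinal j1k1)) /=; last by rewrite -val_eqE /= gtn_eqF.
rewrite gtn_eqF // eqxx step.
transitivity (H *m w j.+1 *m Omega j.+1 +
    (C *m w j.+1 - H *m w j.+1 *m Omega j.+1 - H *m w j *m Psi j.+1
      + H *m w j *m Psi j.+1)).
  by rewrite subrK addrC subrK.
congr (_ + (_ + _)).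
(* The first block column has no superdiagonal block; the corresponding term of the recurrence
   vanishes because [w 0 = 0]. *)
case: j jk {step} jk1 j1k1 => -[|j] jlt jk jk1 j1k1 /=.
  rewrite (block_lanczos_w0 run) mulmx0 mul0mx big1 // => i.
  rewrite -!val_eqE /= => /andP[i0 i1].
  by rewrite (negbTE i0) (negbTE i1) mulmx0.
have jlt' : (j < k.+1)%N by rewrite ltnW // ltnW.
rewrite (bigD1 (Ordinal jlt')) /=; last first.
  by rewrite -!val_eqE /= !ltn_eqF.
rewrite eqxx !ltn_eqF // big1 ?addr0 // => i.
rewrite -!val_eqE /= => /andP[/andP[i0 i1] i2].
by rewrite (negbTE i0) (negbTE i1) eqSS (negbTE i2) mulmx0.
Qed.

End BlockLanczos.

(** * From the tridiagonalization to a block-Lanczos run *)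

Section Tridiag.
Variables (R : realType) (m n : nat) (M : 'M[R]_m) (N : 'M[R]_n) (A : 'M[R]_(m, n)).
Variables (b : 'cV[R]_m) (c : 'cV[R]_n) (k : nat).
Variables (v : nat -> 'cV[R]_m) (u : nat -> 'cV[R]_n) (alpha beta gamma : nat -> R).
Hypothesis run : tridiag_run M N A b c k v u alpha beta gamma.
Hypotheses (symM : M^T = M) (symN : N^T = N).

(** Orthogonality removes the [gamma j] term of [q]. It is a hypothesis here because its own
    inductive proof, which comes next, uses this formula. *)
Lemma tridiag_alpha j : (1 <= j <= k)%N ->
  (v j)^T *m M *m v j.-1 = 0 -> (v j)^T *m A *m u j = (alpha j)%:M.
Proof.
move=> jk vv; have [-> _ _] := tridiag_step run jk.
by rewrite -mx11_scalar mulmxBr -scalemxAr !mulmxA vv scaler0 subr0.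
Qed.

(** Subtracting the [alpha] term removes the component along the current vector. One scalar serves
    both sequences, since [u^T A^T v] is the transpose of [v^T A u]. *)
Lemma tridiag_local_orthogonality j : (j <= k)%N ->
  (v j.+1)^T *m M *m v j = 0 /\ (u j.+1)^T *m N *m u j = 0.
Proof.
elim: j => [_|j IHj jk].
  by rewrite (tridiag_v0 run) (tridiag_u0 run) !mulmx0.
have [vv uu] := IHj (ltnW jk).
have j1k : (1 <= j.+1 <= k)%N by [].
have j1k1 : (1 <= j.+1 <= k.+1)%N by rewrite /= ltnW.
have j2k1 : (1 <= j.+2 <= k.+1)%N by [].
have vAu := tridiag_alpha j1k vv.
have [_ ev eu] := tridiag_step run j1k; rewrite /= in ev eu.
have uAv : (u j.+1)^T *m A^T *m v j.+1 = (alpha j.+1)%:M.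
  by rewrite -[RHS]tr_scalar_mx -vAu !trmx_mul trmxK mulmxA.
(* Transposing puts the newest vector on the right, where its nonzero multiple can be replaced by
   the recurrence. *)
split; apply: trmx_inj; rewrite !trmx_mul trmxK trmx0 ?symM ?symN.
- have /lt0r_neq0 b0 := tridiag_beta_gt0 run j2k1.
  apply: (scalerI b0); rewrite scaler0 scalemxAr ev.
  rewrite !mulmxBr -!scalemxAr !mulmxA vv vAu (tridiag_v_norm run j1k1).
  by rewrite scaler0 subr0 scale_scalar_mx mulr1 subrr.
- have /lt0r_neq0 g0 := tridiag_gamma_gt0 run j2k1.
  apply: (scalerI g0); rewrite scaler0 scalemxAr eu.
  rewrite !mulmxBr -!scalemxAr !mulmxA uu uAv (tridiag_u_norm run j1k1).
  by rewrite scaler0 subr0 scale_scalar_mx mulr1 subrr.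
Qed.

Definition tridiag_block j : 'M[R]_(m + n, 2) := block_mx (v j) 0 0 (u j).

Definition tridiag_Theta j := mx22 1 (alpha j) (alpha j) (- 1).

(* [Psi_1] factors [B] and is diagonal, unlike the later antidiagonal blocks. *)
Definition tridiag_Psi j :=
  if j == 1%N then mx22 (beta j) 0 0 (gamma j) else mx22 0 (gamma j) (beta j) 0.

Lemma tridiag_Psi_unitmx j : (1 <= j <= k.+1)%N -> tridiag_Psi j \in unitmx.
Proof.
move=> jk; rewrite /tridiag_Psi.
have /lt0r_neq0 b0 := tridiag_beta_gt0 run jk.
have /lt0r_neq0 g0 := tridiag_gamma_gt0 run jk.
by case: eqP => _; [exact: mx22_diag_unitmx | exact: mx22_antidiag_unitmx].
Qed.

Lemma tridiag_block_lanczos :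
  block_lanczos_run (block_mx M A A^T (- N)) (block_mx M 0 0 N)
    (block_mx b 0 0 c) k tridiag_block tridiag_Theta tridiag_Psi.
Proof.
have Hw j : block_mx M 0 0 N *m tridiag_block j
    = block_mx (M *m v j) 0 0 (N *m u j) :> 'M_(m + n, 1 + 1).
  by rewrite /tridiag_block (@mulmx_block _ m n m n 1 1) !mul0mx !mulmx0 !addr0 !add0r.
have Kw j : block_mx M A A^T (- N) *m tridiag_block j
    = block_mx (M *m v j) (A *m u j) (A^T *m v j) (- (N *m u j)) :> 'M_(m + n, 1 + 1).
  rewrite /tridiag_block (@mulmx_block _ m n m n 1 1) !mulmx0 !addr0 !add0r.
  by rewrite mulNmx.
have wT j : (tridiag_block j)^T = block_mx (v j)^T 0 0 (u j)^T :> 'M_(1 + 1, m + n).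
  by rewrite /tridiag_block (@tr_block_mx _ m n 1 1) !trmx0.
split.
- by rewrite /tridiag_block (tridiag_v0 run) (tridiag_u0 run) block_mx0.
- rewrite Hw /tridiag_Psi eqxx trmx_mx22 block_diag_mul_mx22 !scale0r.
  by rewrite (tridiag_v1 run) (tridiag_u1 run).
- move=> j jk; rewrite -mulmxA Hw wT (@mulmx_block _ 1 1 m n 1 1).
  rewrite !mul0mx !mulmx0 !addr0 !add0r !mulmxA.
  rewrite (tridiag_v_norm run jk) (tridiag_u_norm run jk).
  exact/esym/(@scalar_mx_block _ 1 1).
- move=> j /andP[j0 jk]; rewrite -mulmxA Kw wT (@mulmx_block _ 1 1 m n 1 1).
  have jk1 : (1 <= j <= k.+1)%N by rewrite j0 ltnW.
  rewrite !mul0mx !addr0 !add0r !mulmxN !mulmxA.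
  rewrite (tridiag_v_norm run jk1) (tridiag_u_norm run jk1).
  have vAu : (v j)^T *m A *m u j = (alpha j)%:M.
    apply: tridiag_alpha; first by rewrite j0.
    case: j j0 jk {jk1} => // j _ jk.
    by have [] := tridiag_local_orthogonality (ltnW jk).
  have -> : (u j)^T *m A^T *m v j = (alpha j)%:M.
    by rewrite -[RHS]tr_scalar_mx -vAu !trmx_mul trmxK mulmxA.
  by rewrite vAu /tridiag_Theta /mx22 raddfN.
- move=> j jk; rewrite !Hw Kw.
  (* For [j = 1] the diagonal [Psi_1] also fits this antidiagonal formula, as [v 0] and [u 0] are
     zero. *)
  have -> : (block_mx (M *m v j.-1) 0 0 (N *m u j.-1) : 'M_(m + n, 1 + 1))
      *m tridiag_Psi j = block_mx 0 (gamma j *: (M *m v j.-1))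
                                  (beta j *: (N *m u j.-1)) 0.
    rewrite /tridiag_Psi; case: eqP => [->|_].
      rewrite (tridiag_v0 run) (tridiag_u0 run) !mulmx0 !scaler0 block_mx0.
      by rewrite mul0mx.
    by rewrite block_diag_mul_mx22 !scale0r.
  have j1 : j.+1 == 1%N = false by case: (j) jk.
  rewrite /tridiag_Psi j1 trmx_mx22 /tridiag_Theta !block_diag_mul_mx22.
  have [_ /= -> ->] := tridiag_step run jk.
  (* The entries [1] and [-1] of [Theta_j] cancel the diagonal blocks of [K w_j]; the off-diagonal
     blocks are the two tridiagonal recurrences. *)
  rewrite !scale0r !scale1r scaleN1r !(@opp_block_mx _ m n 1 1).
  rewrite !(@add_block_mx _ m n 1 1) !oppr0 !addr0 !subrr.
  by rewrite (addrAC (A *m u j)) (addrAC (A^T *m v j)).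
Qed.

End Tridiag.

Theorem theorem2p1 (R : realType) (m n : nat)
    (M : 'M[R]_m) (N : 'M[R]_n) (A : 'M[R]_(m, n))
    (b : 'cV[R]_m) (c : 'cV[R]_n) (k : nat)
    (v : nat -> 'cV[R]_m) (u : nat -> 'cV[R]_n)
    (alpha beta gamma : nat -> R) :
  spd M -> spd N -> b != 0 -> c != 0 -> (1 <= k)%N ->
  tridiag_run M N A b c k v u alpha beta gamma ->
  let K : 'M[R]_(m + n) := block_mx M A A^T (- N) in
  let H : 'M[R]_(m + n) := block_mx M 0 0 N in
  let B : 'M[R]_(m + n, 2) := block_mx b 0 0 c in
  exists (w : nat -> 'M[R]_(m + n, 2)) (Theta Psi : nat -> 'M[R]_2),
    [/\ block_lanczos_run K H B k w Theta Psi,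
        (* any run of the process yields the same blocks w_j, up to the
           orthogonal factor that the process leaves free *)
        forall (w' : nat -> 'M[R]_(m + n, 2)) (Theta' Psi' : nat -> 'M[R]_2),
          block_lanczos_run K H B k w' Theta' Psi' ->
          forall j, (1 <= j <= k.+1)%N ->
          exists2 Q : 'M[R]_2, Q^T *m Q = 1%:M & w' j = w j *m Q,
        forall j, (1 <= j <= k.+1)%N -> w j = block_mx (v j) 0 0 (u j),
        (forall j, (1 <= j <= k)%N ->
           Theta j = mx22 1 (alpha j) (alpha j) (- 1)) /\
        (forall j, (2 <= j <= k.+1)%N ->
           Psi j = mx22 0 (gamma j) (beta j) 0) &
        K *m krylov_basis w k
          = H *m krylov_basis w k.+1 *m lanczos_mx Theta Psi k].
Proof.
move=> spdM spdN _ _ _ run K H B.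
have [symM _] := spdM; have [symN _] := spdN.
have lrun := tridiag_block_lanczos run symM symN.
exists (tridiag_block v u), (tridiag_Theta alpha), (tridiag_Psi beta gamma).
split=> //; last exact: block_lanczos_krylov lrun.
- move=> w' Theta' Psi' run' [//|j] /andP[_ jk].
  have Hu : H \in unitmx.
    rewrite unitmxE det_ublock unitrM -!unitmxE.
    by rewrite (spd_unitmx spdM) (spd_unitmx spdN).
  have [Q [QQ wQ _]] :=
    block_lanczos_unique lrun Hu (tridiag_Psi_unitmx run) run' jk.
  by exists Q.
- by split=> // -[|[|j]].
Qed.
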